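(* Let $N\ge 1$ and $1\le K\le N$ be integers. In the Best-1 case of the Sliding-Window Secretary Problem with $N$ applicants and window size $K$, the optimal strategy is a threshold rule: there is an integer $d^*\ge 0$ such that the strategy that rejects the first $d^*$ applicants and then chooses the next candidate with the sliding rule maximizes the probability of choosing the best applicant among all strategies of the interviewer.
   Context: Setting (Best-1 case). There are $N$ applicants, seen in the order of their indices $1,\dots,N$. $R$ is a uniformly random permutation of $\{1,\dots,N\}$; $R(m)$ is the absolute rank of the applicant at index $m$, with $1$ the best rank. The interviewer knows $N$ and $K$ and observes only the relative ranks of the applicants seen so far. When the window starts at index $i$, it consists of applicants $i,\dots,\min(i+K-1,N)$, and exactly the applicants $1,\dots,\min(i+K-1,N)$ have been seen. At this moment the interviewer may choose any applicant in the window (this ends the process) or reject applicant $i$, in which case the window moves to start at $i+1$; rejected applicants cannot be recalled. A strategy is any rule making these decisions from the relative ranks observed so far. Exactly one applicant can be chosen, and the interviewer wins iff the chosen applicant has rank $1$. A candidate is an applicant in the current window having the best rank among all applicants seen so far. The sliding rule: the window is advanced until a candidate is at the smallest index of the window. Thus, under the sliding rule, the applicant at index $i$ is a candidate iff $R(i)=\min\{R(1),\dots,R(\min(i+K-1,N))\}$. The strategy ''reject the first $d$ applicants and then choose the next candidate with the sliding rule'' chooses the first index $i>d$ such that applicant $i$ is a candidate at the moment when the window starts at $i$ (the first $d$ applicants still count among the seen applicants when deciding who is a candidate). *)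

(* Defs.v *)
From HB Require Import structures.
From mathcomp Require Import all_boot all_order all_fingroup all_algebra.

Set Implicit Arguments.
Unset Strict Implicit.
Unset Printing Implicit Defensive.

Import Order.TTheory GRing.Theory Num.Theory.

(* Indices and ranks are 0-based: applicants are 0, ..., N-1, and R m is the  *)
(* absolute rank of applicant m, with 0 the best rank.                        *)

Definition seen (N K i : nat) : nat := minn (i + K) N.

(* Entry m is the rank of applicant m among applicants 0, ..., n-1.           *)
Definition rel_ranks (N : nat) (R : 'S_N) (n : nat) : seq nat :=
  [seq #|[set j : 'I_N | (j < n) && (R j < R m)]| | m <- take n (enum 'I_N)].

(* s i h is the decision taken when the window starts at i and h lists the    *)
(* relative ranks of the applicants seen so far: Some m chooses applicant m,  *)
(* None rejects applicant i. The earlier relative ranks can be recovered from *)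
(* h, and all earlier decisions were rejections, so h carries the history.    *)
Definition strategy (N : nat) := 'I_N -> seq nat -> option 'I_N.

Definition admissible (N K : nat) (s : strategy N) : Prop :=
  forall (i : 'I_N) (h : seq nat) (m : 'I_N),
    s i h = Some m -> i <= m < seen N K i.

(* The first decision that is not a rejection, if any.                        *)
Definition chosen (N K : nat) (s : strategy N) (R : 'S_N) : option 'I_N :=
  ohead (pmap (fun i : 'I_N => s i (rel_ranks R (seen N K i))) (enum 'I_N)).

Definition wins (N K : nat) (s : strategy N) (R : 'S_N) : bool :=
  if chosen K s R is Some m then R m == 0 :> nat else false.

Definition win_prob (N K : nat) (s : strategy N) : rat :=
  (#|[set R : 'S_N | wins K s R]|%:R / #|[set: 'S_N]|%:R)%R.

Definition optimal (N K : nat) (s : strategy N) : Prop :=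
  admissible K s /\
  forall t : strategy N, admissible K t -> (win_prob K t <= win_prob K s)%R.

Definition candidate (h : seq nat) (i : nat) : bool := nth 1 h i == 0.

Definition sliding_threshold (N d : nat) : strategy N :=
  fun i h => if (d <= i) && candidate h i then Some i else None.

Lemma candidateP (N : nat) (R : 'S_N) (n : nat) (i : 'I_N) : i < n ->
  reflect (forall j : 'I_N, j < n -> R i <= R j) (candidate (rel_ranks R n) i).
Proof.
move=> lt_in; rewrite /candidate (nth_map i); last first.
  by rewrite size_take size_enum_ord; case: ifP => // _; apply: ltn_ord.
rewrite nth_take // nth_ord_enum cards_eq0.
apply: (iffP eqP) => [/setP h j lt_jn | h].
  by have := h j; rewrite !inE lt_jn /= ltnNge => /negbFE.
by apply/setP => j; rewrite !inE; apply/negP => /andP[/h]; rewrite ltnNge => ->.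
Qed.

(* Main.v *)
Require Import Defs.
From HB Require Import structures.
From mathcomp Require Import all_boot all_order all_fingroup all_algebra.
From mathcomp Require Import zify ring.

(* The Lehmer code R |-> (#{j < m : R j < R m})_m is a bijection from 'S_N to *)
(* the product of the {0, ..., m}, so whether applicant n is a record is      *)
(* independent of the relative ranks of the first n applicants, with          *)
(* probability 1 / (n + 1). The process is thus a Markov decision process     *)
(* whose state is the number of applicants seen together with the position of *)
(* the best of them. Its value bounds every strategy by backward induction.   *)
(* Waiting until the best-so-far applicant is about to leave the window costs *)
(* nothing; at that moment, with n applicants seen, choosing it wins with     *)
(* probability n / N, which is nondecreasing in n, while rejecting it is      *)
(* worth the value of having no live candidate, which is nonincreasing in n.  *)
(* The first n at which the former is at least the latter is the threshold.   *)

Set Implicit Arguments.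
Unset Strict Implicit.
Unset Printing Implicit Defensive.

Import Order.TTheory GRing.Theory Num.Theory.

(** Conditional probabilities are replaced by sums over all permutations against a weight [g]
    adapted to the applicants seen so far; the indicator that all earlier decisions were rejections
    is such a weight. Independence of records is [sum_record], which yields the transition law
    [sum_bestS] of the best position and, iterated, the success probability n / N of the current
    best ([sum_best_survive]). Against every such nonnegative weight, [win_from_le] bounds the
    winning mass of any admissible strategy by that of [state_value]; [win_from_threshold] shows
    that the threshold rule attains it. The threshold comes from [threshold_exists], whose
    monotonicity input is [value_dead_homo]. *)

(** * Lehmer digits determine the relative order *)

Definition lehmer (N : nat) (R : 'S_N) (m : 'I_N) : nat :=
  #|[set j : 'I_N | (j < m) && (R j < R m)]|.

Definition agree (N n : nat) (R S : 'S_N) : Prop :=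
  forall m : 'I_N, m < n -> lehmer R m = lehmer S m.

(* The first n Lehmer digits encode the relative ranks of the first n         *)
(* applicants (agree_rel_ranks), so an adapted function depends on these only. *)
Definition adapted (N n : nat) (T : Type) (f : 'S_N -> T) : Prop :=
  forall R S : 'S_N, agree n R S -> f R = f S.

Lemma adaptedW (N n n' : nat) (T : Type) (f : 'S_N -> T) :
  n <= n' -> adapted n f -> adapted n' f.
Proof.
by move=> le_nn' f_n R S RS; apply: f_n => m /leq_trans/(_ le_nn'); apply: RS.
Qed.

Lemma card_ord_lt (N k : nat) : k <= N -> #|[pred j : 'I_N | j < k]| = k.
Proof.
by move=> le_kN; rewrite -sum1_card -(big_ord_widen N (fun=> 1)) // sum1_card card_ord.
Qed.

Lemma lehmer_le (N : nat) (R : 'S_N) (m : 'I_N) : lehmer R m <= m.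
Proof.
rewrite -[leqRHS](card_ord_lt (ltnW (ltn_ord m))); apply: subset_leq_card.
by apply/subsetP => j; rewrite !inE => /andP[].
Qed.

(** By induction [R] and [S] order the earlier applicants alike. Those ranked better than a new
    applicant form an initial segment of this common order, and an initial segment is determined by
    its size, which is the Lehmer digit. *)
Lemma agree_order (N n : nat) (R S : 'S_N) : agree n R S ->
  forall i j : 'I_N, i < n -> j < n -> (R i < R j) = (S i < S j).
Proof.
elim: n => // n IHn RS.
have {}IHn := IHn (fun m lt_mn => RS m (ltnW lt_mn)).
have key (i j : 'I_N) : i < n -> j = n :> nat -> (R i < R j) = (S i < S j).
  move=> lt_in eq_jn.
  pose A (T : 'S_N) := [set l : 'I_N | (l < j) && (T l < T j)].
  have cAB : #|A R| = #|A S| by apply: RS; rewrite eq_jn.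
  suff AB : A R = A S.
    by have /setP/(_ i) := AB; rewrite !inE eq_jn lt_in.
  have [/subsetP sAB | /subsetPn[x]] := boolP (A R \subset A S).
    by apply/eqP; rewrite eqEcard cAB leqnn andbT; apply/subsetP.
  rewrite !inE eq_jn => /andP[lt_xn Rx]; rewrite lt_xn /= -leqNgt => Sx.
  apply/esym/eqP; rewrite eqEcard cAB leqnn andbT; apply/subsetP => y.
  rewrite !inE eq_jn => /andP[lt_yn Sy]; rewrite lt_yn /=.
  by apply: ltn_trans Rx; rewrite IHn // (leq_trans Sy).
move=> i j; rewrite ltnS leq_eqVlt => /predU1P[i_n|lt_in];
  rewrite ltnS leq_eqVlt => /predU1P[j_n|lt_jn]; last exact: IHn.
- by rewrite (_ : i = j) ?ltnn //; apply: val_inj; rewrite /= i_n.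
- have neq_ij : j != i by rewrite -val_eqE /=; lia.
  have nlt (T : 'S_N) : (T i < T j) = ~~ (T j < T i).
    have : T j != T i by rewrite (inj_eq perm_inj).
    by rewrite -val_eqE /=; lia.
  by rewrite !nlt key.
- exact: key.
Qed.

Lemma agree_rel_ranks (N n : nat) : adapted n (fun R : 'S_N => rel_ranks R n).
Proof.
move=> R S RS; apply/eq_in_map => m m_n; apply: eq_card => j; rewrite !inE.
have [lt_jn /= | //] := boolP (j < n).
apply: agree_order RS _ _ lt_jn _.
have : val m \in map val (take n (enum 'I_N)) by exact: map_f.
rewrite map_take val_enum_ord take_iota mem_iota add0n leq_min.
by case/andP=> _ /andP[].
Qed.

Lemma agree_full (N : nat) (R S : 'S_N) : agree N R S -> R = S.
Proof.
move=> RS; have rank (T : 'S_N) m : #|[set j | T j < T m]| = T m.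
  have -> : [set j | T j < T m] = T @^-1: [set k : 'I_N | k < T m].
    by apply/setP => j; rewrite !inE.
  rewrite card_preimset; last exact: perm_inj.
  by rewrite cardsE card_ord_lt // ltnW.
apply/permP => m; apply: val_inj; rewrite -[LHS]rank -[RHS]rank.
by apply: eq_card => j; rewrite !inE; apply: agree_order RS _ _ _ _.
Qed.

(** * Bijectivity of the Lehmer code and uniformity of its digits *)

Definition lehmer_ffun (N : nat) (R : 'S_N) : {ffun 'I_N -> 'I_N} :=
  [ffun m => Ordinal (leq_ltn_trans (lehmer_le R m) (ltn_ord m))].

Lemma lehmer_ffun_inj (N : nat) : injective (@lehmer_ffun N).
Proof.
move=> R S /ffunP RS; apply: agree_full => m _.
by have := congr1 val (RS m); rewrite !ffunE.
Qed.

(** Counting: the code is injective, and there are N! admissible digit sequences, as many as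
    permutations. *)
Lemma lehmer_onto (N : nat) (f : {ffun 'I_N -> 'I_N}) :
  (forall m, f m <= m) -> exists R : 'S_N, lehmer_ffun R = f.
Proof.
move=> f_le; pose F (m : 'I_N) := [pred k : 'I_N | k <= m].
have cF : #|family F| = N`!.
  rewrite card_family foldrE big_map enumT fact_prod big_add1 /= big_mkord.
  by apply: eq_bigr => m _; apply: (@card_ord_lt N m.+1).
have sub : [set lehmer_ffun R | R : 'S_N] \subset [set g in family F].
  apply/subsetP => _ /imsetP[R _ ->]; rewrite inE; apply/familyP => m.
  by rewrite !inE ffunE /=; exact: lehmer_le.
have /eqP eqF : [set lehmer_ffun R | R : 'S_N] == [set g in family F].
  rewrite eqEcard sub cardsE cF card_imset; last exact: lehmer_ffun_inj.
  by rewrite card_Sn leqnn.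
have : f \in [set g in family F] by rewrite inE; apply/familyP => m; rewrite inE.
by rewrite -eqF => /imsetP[R _ ->]; exists R.
Qed.

(* Exchanging the values 0 and k of the n-th Lehmer digit is a bijection of   *)
(* 'S_N fixing all smaller digits: each of the n + 1 values of this digit     *)
(* carries the same weight.                                                   *)
Lemma sum_lehmer_eq (N : nat) (n : 'I_N) (k : nat) (g : 'S_N -> rat) :
  adapted n g -> k <= n ->
  (\sum_(R | lehmer R n == k) g R = \sum_(R | lehmer R n == 0) g R)%R.
Proof.
move=> g_n le_kn.
have lt_kN : k < N by apply: leq_ltn_trans le_kn (ltn_ord n).
have N_gt0 : 0 < N by apply: leq_ltn_trans lt_kN.
pose t := tperm (Ordinal N_gt0) (Ordinal lt_kN).
pose sw (f : {ffun 'I_N -> 'I_N}) := [ffun m => if m == n then t (f m) else f m].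
have sw_inj : injective sw.
  move=> f1 f2 /ffunP eqf; apply/ffunP => m; have := eqf m; rewrite !ffunE.
  by case: eqP => // _ /perm_inj.
have /fin_all_exists[s s_sw] (R : 'S_N) : exists S, lehmer_ffun S = sw (lehmer_ffun R).
  apply: lehmer_onto => m; rewrite !ffunE; case: eqP => [->|_]; last exact: lehmer_le.
  by case: tpermP => //= _ _; exact: lehmer_le.
have s_inj : injective s.
  by move=> R S eqs; apply/lehmer_ffun_inj/sw_inj; rewrite -!s_sw eqs.
have sE R m : lehmer (s R) m = sw (lehmer_ffun R) m.
  by rewrite -s_sw ffunE.
rewrite (reindex_inj s_inj) /=; apply: eq_big => R => [|_].
  rewrite sE ffunE eqxx; set x := lehmer_ffun R n.
  have -> : lehmer R n = x by rewrite /x ffunE.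
  rewrite -[LHS]/(t x == Ordinal lt_kN) -[RHS]/(x == Ordinal N_gt0).
  by rewrite -[Ordinal lt_kN](tpermL (Ordinal N_gt0)) (inj_eq perm_inj).
apply: g_n => m lt_mn; rewrite sE !ffunE /= ifN // -val_eqE /=.
by rewrite neq_ltn lt_mn.
Qed.

(** Since [g] is an arbitrary function of the past, this is the independence of the record event
    from the past, with probability 1 / (n + 1). *)
Lemma sum_record (N : nat) (n : 'I_N) (g : 'S_N -> rat) : adapted n g ->
  (n.+1%:R * \sum_(R | lehmer R n == 0) g R = \sum_R g R)%R.
Proof.
move=> g_n.
rewrite [RHS](partition_big (fun R => inord (lehmer R n) : 'I_n.+1) predT) //=.
rewrite -[n.+1 in LHS]card_ord mulr_natl -sumr_const.
apply: eq_bigr => k _; rewrite -(sum_lehmer_eq g_n (leq_ord k)).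
apply: eq_bigl => R; rewrite -val_eqE /= inordK // ltnS; exact: lehmer_le.
Qed.

(** * Position of the best applicant seen so far *)

(** The existential turns the natural number [n'] into an index; it fails for [n'] at least [N], so
    [best] then stays constant. The value 0 at [n = 0] is a default. *)
Fixpoint best (N : nat) (R : 'S_N) (n : nat) : nat :=
  if n is n'.+1 then
    if [exists m : 'I_N, (m == n' :> nat) && (lehmer R m == 0)] then n' else best R n'
  else 0.

Lemma bestS (N : nat) (R : 'S_N) (n : 'I_N) :
  best R n.+1 = if lehmer R n == 0 then val n else best R n.
Proof.
rewrite /=; congr (if _ then _ else _).
by apply/existsP/idP => [[m /andP[/eqP/val_inj ->]] | n0] //; exists n; rewrite eqxx.
Qed.

Lemma best_lt (N : nat) (R : 'S_N) (n : nat) : 0 < n -> best R n < n.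
Proof.
case: n => // n _; elim: n => [|n IHn]; first by rewrite /=; case: ifP.
by rewrite [best R n.+2]/=; case: ifP => // _; apply: leq_trans IHn _.
Qed.

Lemma adapted_best (N n : nat) : adapted n (fun R : 'S_N => best R n).
Proof.
elim: n => // n IHn R S RS /=; rewrite (IHn R S); last first.
  by move=> m /ltnW; apply: RS.
congr (if _ then _ else _); apply: eq_existsb => m.
by have [eq_mn|//] := eqVneq (val m) n; rewrite (RS m) // eq_mn.
Qed.

Lemma bestP (N : nat) (R : 'S_N) (n : nat) (i : 'I_N) : i < n <= N ->
  reflect (forall j : 'I_N, j < n -> R i <= R j) (best R n == i).
Proof.
case/andP=> lt_in le_nN; elim: n i le_nN lt_in => // n IHn i lt_nN lt_in.
pose o := Ordinal lt_nN; rewrite (bestS R o).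
have lehmer0 : reflect (forall j : 'I_N, j < n -> R o <= R j) (lehmer R o == 0).
  rewrite cards_eq0; apply: (iffP eqP) => [/setP h j lt_jn | h].
    by have := h j; rewrite !inE lt_jn /= ltnNge => /negbFE.
  by apply/setP => j; rewrite !inE; apply/negP => /andP[/h]; rewrite ltnNge => ->.
have [eq_in | neq_in] := eqVneq i o.
  rewrite eq_in; case: lehmer0 => [min_o | not_min].
    rewrite eqxx; constructor=> j; rewrite ltnS leq_eqVlt => /predU1P[eq_jn|]; last exact: min_o.
    by rewrite (_ : j = o) //; apply: val_inj.
  rewrite [_ == _]negbTE; first by constructor=> h; apply: not_min => j /ltnW; apply: h.
  have [n0|n_gt0] := posnP n; first by case: not_min => j; rewrite n0.
  by rewrite neq_ltn best_lt.
have lt_i : i < n.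
  by have := neq_in; rewrite -val_eqE /=; move: lt_in; rewrite ltnS leq_eqVlt => /orP[->|].
have neqR : R i != R o by rewrite (inj_eq perm_inj).
case: lehmer0 => [min_o | not_min].
  rewrite eq_sym val_eqE (negbTE neq_in); constructor=> h.
  have := min_o i lt_i; have := h o (ltnSn n); move: neqR; rewrite -val_eqE /=; lia.
apply: (iffP (IHn i (ltnW lt_nN) lt_i)) => h j; last by move/ltnW; apply: h.
rewrite ltnS leq_eqVlt => /predU1P[eq_jn|]; last exact: h.
have -> : j = o by apply: val_inj.
rewrite leqNgt; apply/negP => lt_oi; apply: not_min => l /h.
exact/leq_trans/ltnW.
Qed.

Lemma candidate_best (N : nat) (R : 'S_N) (n : nat) (i : 'I_N) : i < n <= N ->
  candidate (rel_ranks R n) i = (best R n == i).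
Proof.
by move=> lt_in; case/andP: (lt_in) => ? _; apply/candidateP/bestP.
Qed.

Lemma best_rank0 (N : nat) (R : 'S_N) (i : 'I_N) : (best R N == i) = (R i == 0 :> nat).
Proof.
have lt_iN : i < N <= N by rewrite ltn_ord leqnn.
apply/(bestP R lt_iN)/eqP => [h|-> //].
have N_gt0 : 0 < N by apply: leq_ltn_trans (ltn_ord i).
have := h (R^-1%g (Ordinal N_gt0)) (ltn_ord _).
by rewrite permKV leqn0 => /eqP.
Qed.

(** * Transition law of the best position *)

Local Open Scope ring_scope.

(** Applicant [n] is a record with probability 1 / (n + 1), independently of the past; otherwise the
    best position does not move. *)
Lemma sum_bestS (N : nat) (n : nat) (h : 'S_N -> nat -> rat) : (n < N)%N ->
  (forall b, adapted n (h^~ b)) ->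
  \sum_R h R (best R n.+1) =
    \sum_R (n%:R * h R (best R n) + h R n) / n.+1%:R.
Proof.
move=> lt_nN h_n; pose o := Ordinal lt_nN.
have hb_n : adapted n (fun R => h R (best R n)).
  by move=> R S RS; rewrite (adapted_best RS); apply: h_n.
have rec_b := sum_record (n := o) hb_n; have rec_n := sum_record (n := o) (h_n n).
have split_b := bigID (fun R => lehmer R o == 0%N) predT
  (fun R => h R (best R n)) : \sum_R _ = _.
under eq_bigr => R _ do rewrite (bestS R o : best R n.+1 = _).
rewrite -mulr_suml big_split /= -mulr_sumr -rec_n -rec_b.
rewrite (bigID (fun R => lehmer R o == 0%N)) /=.
under eq_bigr => R R0 do rewrite R0.
under [X in _ + X]eq_bigr => R R0 do rewrite (negbTE R0).
(* The total is n + 1 times the record part, so the non-record part is n times it. *)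
rewrite [X in _ + X](_ : _ = n%:R * \sum_(R | lehmer R o == 0%N) h R (best R n)).
  by rewrite -natr1; field; rewrite natr1 pnatr_eq0.
apply: (addrI (\sum_(R | lehmer R o == 0%N) h R (best R n))).
by rewrite -split_b -rec_b -natr1 mulrDl mul1r addrC.
Qed.

(** As [h] vanishes at positions not yet seen at time [n], each transition only contributes its
    survival factor m / (m + 1), and the product telescopes. *)
Lemma sum_best_survive (N n n' : nat) (h : 'S_N -> nat -> rat) :
  (0 < n)%N -> (n <= n' <= N)%N -> (forall b, adapted n (h^~ b)) ->
  (forall R b, (n <= b)%N -> h R b = 0) ->
  \sum_R h R (best R n') = n%:R / n'%:R * \sum_R h R (best R n).
Proof.
move=> n_gt0 + h_n h0; elim: n' => [|n' IHn]; first by lia.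
case/andP; rewrite leq_eqVlt => /predU1P[<- _|lt_nn' lt_n'N].
  by rewrite divff ?mul1r // pnatr_eq0 -lt0n.
rewrite sum_bestS // => [|b]; last exact: adaptedW (h_n b).
rewrite -mulr_suml big_split /= -mulr_sumr.
rewrite [X in _ + X]big1 => [|R _]; last exact: h0.
rewrite IHn; last by lia.
have n'_neq0 : (n'%:R != 0 :> rat) by rewrite pnatr_eq0; lia.
have n'S_neq0 : (n'.+1%:R != 0 :> rat) by rewrite pnatr_eq0.
by rewrite addr0; field; rewrite nat1r n'S_neq0.
Qed.

(** * The value function and its monotonicity *)

(* Optimal winning probability when k applicants are still unseen and the     *)
(* best one seen so far leaves the window after c further moves; c = 0 means  *)
(* that it has already been rejected. A new record enters with c = K.         *)
Fixpoint value (N K k c : nat) : rat :=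
  if k is k'.+1 then
    Num.max (if (0 < c)%N then (N - k)%:R / N%:R else 0)
            (((N - k)%:R * value N K k' c.-1 + value N K k' K) / (N - k')%:R)
  else (0 < c)%:R.

Definition cont_value (N K k c : nat) : rat :=
  ((N - k.+1)%:R * value N K k c.-1 + value N K k K) / (N - k)%:R.

Lemma valueS (N K k c : nat) : value N K k.+1 c =
  Num.max (if (0 < c)%N then (N - k.+1)%:R / N%:R else 0) (cont_value N K k c).
Proof. by []. Qed.

Lemma value_ge0 (N K k c : nat) : 0 <= value N K k c.
Proof.
case: k => [|k]; first exact: ler0n.
rewrite valueS le_max; apply/orP; left; case: ifP => // _.
by rewrite divr_ge0.
Qed.

Lemma cont_value_ge0 (N K k c : nat) : 0 <= cont_value N K k c.
Proof. by rewrite divr_ge0 // addr_ge0 ?mulr_ge0 ?value_ge0. Qed.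

Lemma value_dead (N K k : nat) : value N K k.+1 0 = cont_value N K k 0.
Proof. by rewrite valueS /= max_r // cont_value_ge0. Qed.

Lemma value_stop (N K k c : nat) : (0 < N)%N -> (0 < c)%N ->
  (N - k)%:R / N%:R <= value N K k c.
Proof.
move=> N_gt0 c_gt0; case: k => [|k]; last by rewrite valueS c_gt0 le_max lexx.
by rewrite subn0 divff /= ?c_gt0 // pnatr_eq0 -lt0n.
Qed.

(** By induction: a dead state stays dead, and the term for a new record does not depend on [c]. *)
Lemma value_dead_min (N K k c : nat) : value N K k 0 <= value N K k c.
Proof.
elim: k c => [|k IHk] c; first by rewrite /= ler_nat.
rewrite value_dead valueS le_max; apply/orP; right.
by rewrite /cont_value ler_wpM2r ?invr_ge0 // lerD2r ler_wpM2l.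
Qed.

(** One more unseen applicant makes the dead value a weighted mean of [value N K k' 0] and
    [value N K k' K], and the former is the smaller of the two. *)
Lemma value_dead_homo (N K k k' : nat) : (k <= k' <= N)%N ->
  value N K k 0 <= value N K k' 0.
Proof.
case/andP; elim: k' => [|k' IHk]; first by rewrite leqn0 => /eqP->.
rewrite leq_eqVlt => /predU1P[-> // | lt_kk'] lt_k'N.
apply: le_trans (IHk lt_kk' (ltnW lt_k'N)) _.
rewrite value_dead ler_pdivlMr ?ltr0n ?subn_gt0 //.
rewrite -(subnSK lt_k'N) -natr1 mulrDr mulr1 mulrC lerD2l.
exact: value_dead_min.
Qed.

(* A best-so-far applicant that stays in the window need not be chosen yet. *)
Lemma cont_value_stop (N K k c : nat) : (k < N)%N -> (1 < c)%N ->
  (N - k.+1)%:R / N%:R <= cont_value N K k c.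
Proof.
move=> lt_kN c_gt1.
have N_gt0 : (0 < N)%N by apply: leq_ltn_trans lt_kN.
rewrite ler_pdivlMr ?ltr0n ?subn_gt0 //.
have c1 : (0 < c.-1)%N by lia.
have := @value_stop N K k c.-1 N_gt0 c1.
have := value_ge0 N K k K.
set v := value N K k K; set w := value N K k c.-1; set n := (N - k.+1)%:R; set n1 := (N - k)%:R.
move=> v0 /(ler_wpM2l (ler0n _ (N - k.+1))); rewrite -/n mulrA mulrAC => le.
by rewrite -[leLHS]addr0 lerD.
Qed.

(* When the best applicant seen was rejected, the truncated subtraction gives *)
(* the state 0.                                                               *)
Definition state_value (N K i : nat) (R : 'S_N) : rat :=
  value N K (N - seen N K i) ((best R (seen N K i)).+1 - i).

Lemma seen_le (N K i : nat) : (seen N K i <= N)%N.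
Proof. exact: geq_minr. Qed.

Lemma seen_leS (N K i : nat) : (seen N K i <= seen N K i.+1)%N.
Proof. by rewrite /seen; lia. Qed.

Lemma adapted_state (N K i : nat) :
  adapted (seen N K i) (@state_value N K i).
Proof. by move=> R S RS; rewrite /state_value (adapted_best RS). Qed.

(** Exactly one new applicant enters the window here, so this is one application of [sum_bestS]; a
    new record is then [K] moves away from leaving. *)
Lemma sum_state_valueS (N K i : nat) (g : 'S_N -> rat) : (i + K < N)%N ->
  adapted (i + K) g ->
  \sum_R g R * state_value K i.+1 R =
  \sum_R g R * cont_value N K (N - (i + K).+1) ((best R (i + K)).+1 - i).
Proof.
move=> lt_iKN g_n.
have sS : seen N K i.+1 = (i + K).+1 by rewrite /seen; lia.
pose h R b := g R * value N K (N - (i + K).+1) (b.+1 - i.+1).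
transitivity (\sum_R h R (best R (i + K).+1)).
  by apply: eq_bigr => R _; rewrite /state_value sS.
rewrite sum_bestS // => [|b R S RS]; last by rewrite /h (g_n _ _ RS).
apply: eq_bigr => R _; rewrite /h /cont_value.
have -> : (N - (N - (i + K).+1) = (i + K).+1)%N by lia.
have -> : (N - (N - (i + K).+1).+1 = i + K)%N by lia.
have -> : ((i + K).+1 - i.+1 = K)%N by lia.
by rewrite (subnS _ i); ring.
Qed.

(** * Upper bound for every admissible strategy *)

Definition win_from (N K : nat) (s : strategy N) (i : nat) (R : 'S_N) : bool :=
  if ohead (pmap (fun j : 'I_N => s j (rel_ranks R (seen N K j))) (drop i (enum 'I_N)))
  is Some m then R m == 0%N :> nat else false.

Lemma win_fromE (N K : nat) (s : strategy N) (i : 'I_N) (R : 'S_N) :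
  win_from K s i R = if s i (rel_ranks R (seen N K i)) is Some m
                     then R m == 0%N :> nat else win_from K s i.+1 R.
Proof.
rewrite /win_from (drop_nth i) ?size_enum_ord // nth_ord_enum /=.
by case: (s i _).
Qed.

Lemma win_from_last (N K : nat) (s : strategy N) (R : 'S_N) : win_from K s N R = false.
Proof. by rewrite /win_from drop_oversize // size_enum_ord. Qed.

(** Conditional winning probability of an immediate choice: n / N for the best applicant seen, 0 for
    any other. *)
Definition stop_weight (N K : nat) (s : strategy N) (i : 'I_N) (R : 'S_N) : rat :=
  if s i (rel_ranks R (seen N K i)) is Some m then
    (best R (seen N K i) == m)%:R * ((seen N K i)%:R / N%:R)
  else 0.

Definition rejects (N K : nat) (s : strategy N) (i : 'I_N) (R : 'S_N) : bool :=
  ~~ isSome (s i (rel_ranks R (seen N K i))).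

Lemma sum_win_from (N K : nat) (s : strategy N) (i : 'I_N) (g : 'S_N -> rat) :
  (0 < K)%N -> admissible K s -> adapted (seen N K i) g ->
  \sum_R g R * (win_from K s i R)%:R =
  \sum_R g R * stop_weight K s i R +
  \sum_R g R * (rejects K s i R)%:R * (win_from K s i.+1 R)%:R.
Proof.
move=> K_gt0 s_adm g_n; set n := seen N K i.
have N_gt0 : (0 < N)%N by apply: leq_ltn_trans (ltn_ord i).
(* [b] stands for the position of the overall best applicant; an admissible choice has been seen, so
   [h] vanishes for [b] at least [n]. *)
pose h R (b : nat) : rat := g R * (if s i (rel_ranks R n) is Some m then (b == m :> nat)%:R else 0).
have := @sum_best_survive N n N h.
have n_gt0 : (0 < n)%N by rewrite /n /seen; lia.
move=> /(_ n_gt0); rewrite seen_le leqnn => /(_ isT) survive.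
have {survive} -> : \sum_R g R * stop_weight K s i R = \sum_R h R (best R N).
  rewrite survive => [|b R S RS|R b le_nb].
  - rewrite mulr_sumr; apply: eq_bigr => R _; rewrite /h /stop_weight -/n.
    by case: (s i _) => [m|]; ring.
  - by rewrite /h (g_n _ _ RS) (agree_rel_ranks RS).
  - rewrite /h; case E: (s i _) => [m|]; last by rewrite mulr0.
    have /andP[_ lt_mn] := s_adm _ _ _ E.
    by rewrite gtn_eqF ?mulr0 // (leq_trans lt_mn).
rewrite -big_split; apply: eq_bigr => R _ /=; rewrite win_fromE /h /rejects -/n.
by case: (s i _) => [m|] /=; rewrite ?best_rank0 ?mulr0 ?mul0r ?addr0 ?add0r ?mulr1.
Qed.

Lemma adapted_rejects (N K : nat) (s : strategy N) (i : 'I_N) :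
  adapted (seen N K i) (rejects K s i).
Proof. by move=> R S RS; rewrite /rejects (agree_rel_ranks RS). Qed.

(** Supermartingale property: moving the window is one option in the maximum defining [value]. Once
    everybody has been seen, moving can only lose the best applicant. *)
Lemma sum_state_value_le (N K i : nat) (g : 'S_N -> rat) :
  (forall R, 0 <= g R) -> adapted (seen N K i) g ->
  \sum_R g R * state_value K i.+1 R <= \sum_R g R * state_value K i R.
Proof.
move=> g_ge0 g_n; have [lt_iKN | le_NiK] := ltnP (i + K) N.
  have sE : seen N K i = (i + K)%N by rewrite /seen; lia.
  rewrite sE in g_n; rewrite sum_state_valueS //; apply: ler_sum => R _; rewrite ler_wpM2l //.
  rewrite /state_value sE -(subnSK lt_iKN) valueS le_max; apply/orP; right.
  by rewrite lexx.
apply: ler_sum => R _; rewrite ler_wpM2l // /state_value.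
have [-> ->] : seen N K i = N /\ seen N K i.+1 = N by rewrite /seen; lia.
by rewrite subnn /= ler_nat; lia.
Qed.

Lemma state_value_split (N K : nat) (s : strategy N) (i : 'I_N) (R : 'S_N) :
  admissible K s ->
  stop_weight K s i R + (rejects K s i R)%:R * state_value K i R <= state_value K i R.
Proof.
have N_gt0 : (0 < N)%N by apply: leq_ltn_trans (ltn_ord i).
move=> s_adm; rewrite /stop_weight /rejects; case E: (s i _) => [m|] /=.
  rewrite mul0r addr0; case: eqP => [eq_bm|_]; last by rewrite mul0r value_ge0.
  have /andP[le_im _] := s_adm _ _ _ E.
  rewrite mul1r -{1}(subKn (seen_le N K i)) value_stop // eq_bm; lia.
by rewrite mul1r add0r.
Qed.

(** Backward induction on the window, for all weights at once, because each step multiplies [g] by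
    the indicator of rejection. *)
Lemma win_from_le (N K : nat) (s : strategy N) (i : nat) (g : 'S_N -> rat) :
  (0 < K)%N -> admissible K s -> (i <= N)%N ->
  (forall R, 0 <= g R) -> adapted (seen N K i) g ->
  \sum_R g R * (win_from K s i R)%:R <= \sum_R g R * state_value K i R.
Proof.
move=> K_gt0 s_adm /subnKC; move: (N - i)%N => k; elim: k i g => [|k IHk] i g.
  rewrite addn0 => -> g_ge0 _; apply: ler_sum => R _; rewrite win_from_last.
  by rewrite ler_wpM2l // value_ge0.
rewrite addnS => eqN g_ge0 g_n.
have lt_iN : (i < N)%N by lia.
have := sum_win_from (i := Ordinal lt_iN) K_gt0 s_adm g_n => /= ->.
set o := Ordinal lt_iN.
pose g' R := g R * (rejects K s o R)%:R.
have g'_ge0 R : 0 <= g' R by rewrite mulr_ge0.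
have g'_n : adapted (seen N K i) g'.
  by move=> R S RS; rewrite /g' (g_n _ _ RS) (@adapted_rejects _ K s o _ _ RS).
have le1 := IHk i.+1 g' eqN g'_ge0 (adaptedW (seen_leS N K i) g'_n).
have le2 := le_trans le1 (sum_state_value_le g'_ge0 g'_n).
apply: (le_trans (lerD (lexx _) le2)).
rewrite -big_split /=; apply: ler_sum => R _.
by rewrite -mulrA -mulrDr ler_wpM2l //; exact: (state_value_split o).
Qed.

(** * The threshold rule attains the value *)

Lemma threshold_admissible (N K d : nat) :
  (0 < K)%N -> admissible K (@sliding_threshold N d).
Proof.
move=> K_gt0 i h m; rewrite /sliding_threshold; case: ifP => // _ [<-].
by rewrite leqnn /seen; have := ltn_ord i; lia.
Qed.

(** As [i] grows, n / N does not decrease and the dead value does not increase, so the comparison,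
    once true, stays true. It holds at [i = N], where the dead value is 0. *)
Lemma threshold_exists (N K : nat) : (0 < N)%N -> exists d : nat,
  forall i : nat, (i < N)%N ->
  (d <= i)%N = (value N K (N - seen N K i) 0 <= (seen N K i)%:R / N%:R).
Proof.
move=> N_gt0; pose D i := value N K (N - seen N K i) 0 <= (seen N K i)%:R / N%:R.
have D_N : exists i, D i.
  exists N; rewrite /D (_ : seen N K N = N); last by rewrite /seen; lia.
  by rewrite subnn /= divr_ge0.
exists (ex_minn D_N) => i _; case: ex_minnP => d Dd min_d.
apply/idP/idP => [le_di|]; last exact: min_d.
have le_seen : (seen N K d <= seen N K i)%N by rewrite /seen; lia.
apply: le_trans (le_trans Dd _).
  by apply: value_dead_homo; rewrite leq_sub2l //= leq_subr.
by rewrite ler_wpM2r ?invr_ge0 // ler_nat.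
Qed.

Lemma win_from_threshold (N K d : nat) (i : nat) (g : 'S_N -> rat) :
  (0 < N)%N -> (0 < K)%N -> (i <= N)%N ->
  (forall i : nat, (i < N)%N ->
    (d <= i)%N = (value N K (N - seen N K i) 0 <= (seen N K i)%:R / N%:R)) ->
  adapted (seen N K i) g ->
  \sum_R g R * (win_from K (@sliding_threshold N d) i R)%:R =
  \sum_R g R * state_value K i R.
Proof.
move=> N_gt0 K_gt0 + d_thr; move/subnKC; move: (N - i)%N => k; elim: k i g => [|k IHk] i g.
  rewrite addn0 => -> _; apply: eq_bigr => R _; rewrite win_from_last.
  rewrite /state_value (_ : seen N K N = N); last by rewrite /seen; lia.
  by rewrite subnn /= subn_gt0 ltnS leqNgt best_lt.
rewrite addnS => eqN g_n.
have lt_iN : (i < N)%N by lia.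
have := sum_win_from (i := Ordinal lt_iN) K_gt0 (threshold_admissible (d := d) K_gt0) g_n => /= ->.
set o := Ordinal lt_iN; set s := @sliding_threshold N d.
pose g' R := g R * (rejects K s o R)%:R.
have g'_n : adapted (seen N K i) g'.
  by move=> R S RS; rewrite /g' (g_n _ _ RS) (@adapted_rejects _ K s o _ _ RS).
have := IHk i.+1 g' eqN (adaptedW (seen_leS N K i) g'_n); rewrite /g' => ->.
have lt_in : (i < seen N K i)%N by rewrite /seen; lia.
have sE (R : 'S_N) : s o (rel_ranks R (seen N K i)) =
    if (d <= i)%N && (best R (seen N K i) == i) then Some o else None.
  have lt_in_N : (o < seen N K i <= N)%N by rewrite lt_in seen_le.
  by rewrite /s /sliding_threshold -(candidate_best R lt_in_N).
have stopE R : stop_weight K s o R =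
    if (d <= i)%N && (best R (seen N K i) == i) then (seen N K i)%:R / N%:R else 0.
  by rewrite /stop_weight sE; case: ifP => // /andP[_ ->]; rewrite mul1r.
have rejE R : rejects K s o R = ~~ ((d <= i)%N && (best R (seen N K i) == i)).
  by rewrite /rejects sE; case: ifP.
have dE := d_thr i lt_iN.
have [lt_iKN | le_NiK] := ltnP (i + K) N.
  have seenE : seen N K i = (i + K)%N by rewrite /seen; lia.
  rewrite (@sum_state_valueS N K i g') // -?seenE //.
  rewrite -big_split /=; apply: eq_bigr => R _.
  rewrite stopE /g' rejE /state_value.
  set k' := (N - (seen N K i).+1)%N.
  have kE : (N - seen N K i = k'.+1)%N by rewrite /k'; lia.
  have nE : (N - k'.+1 = seen N K i)%N by rewrite /k'; lia.
  rewrite kE in dE *; rewrite valueS nE.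
  rewrite value_dead in dE.
  have lt_k'N : (k' < N)%N by rewrite /k'; lia.
  (* The best applicant seen is already rejected: the rule does not stop, and only continuing has
     value. *)
  have [c0 | c_gt0] := posnP ((best R (seen N K i)).+1 - i).
    rewrite c0 /= max_r ?cont_value_ge0 // (_ : best R _ == i = false) ?andbF /=; last by lia.
    by rewrite mulr0 add0r mulr1.
  (* The best applicant seen is about to leave: rejecting it is worth the dead value, so by [dE] the
     rule picks the larger term of the maximum. *)
  have [c1|c_neq1] := eqVneq ((best R (seen N K i)).+1 - i)%N 1%N.
    rewrite c1 (_ : best R _ == i = true) ?andbT /=; last by lia.
    rewrite dE -/(cont_value N K k' 0).
    have -> : cont_value N K k' 1 = cont_value N K k' 0 by [].
    case: leP => le /=; first by rewrite mulr0 mul0r addr0.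
    by rewrite mulr0 add0r mulr1.
  (* The best applicant seen survives the move, so waiting is optimal by [cont_value_stop]. *)
  have c_gt1 : (1 < (best R (seen N K i)).+1 - i)%N by lia.
  rewrite (_ : best R _ == i = false) ?andbF /=; last by lia.
  rewrite max_r; first by rewrite mulr0 add0r mulr1.
  by have := cont_value_stop K lt_k'N c_gt1; rewrite nE.
(* Everybody has been seen: the dead value is 0, the threshold is passed, and the value is 1 exactly
   while the best applicant has not been rejected. *)
have [seenE seenSE] : seen N K i = N /\ seen N K i.+1 = N by rewrite /seen; lia.
have le_di : (d <= i)%N by rewrite dE seenE subnn /= divr_ge0.
rewrite -big_split /=; apply: eq_bigr => R _.
rewrite stopE rejE le_di /state_value seenE seenSE subnn /=.
have [->|neq] := eqVneq (best R N) i.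
  by rewrite mulr0 mul0r addr0 subSnn divff // pnatr_eq0 -lt0n.
rewrite mulr0 add0r mulr1; congr (_ * (nat_of_bool _)%:R); lia.
Qed.

Lemma win_probE (N K : nat) (s : strategy N) :
  win_prob K s = (\sum_(R : 'S_N) 1 * (win_from K s 0 R)%:R) / #|[set: 'S_N]|%:R.
Proof.
rewrite /win_prob -sum1_card natr_sum big_mkcond /=; congr (_ / _).
apply: eq_bigr => R _; rewrite mul1r inE /wins /chosen /win_from drop0.
by case: (ohead _) => // m; case: eqP.
Qed.

Local Close Scope ring_scope.

Theorem theorem3p1 (N K : nat) (hN : 1 <= N) (hK : 1 <= K) (hKN : K <= N) :
  exists d : nat, optimal K (@sliding_threshold N d).
Proof.
have [d d_thr] := threshold_exists K hN.
exists d; split=> [|t t_adm]; first exact: threshold_admissible.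
rewrite !win_probE ler_wpM2r ?invr_ge0 // (win_from_threshold hN hK _ d_thr) //.
by apply: win_from_le.
Qed.
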